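(* Let $(A,\ast,\alpha)$ be a multiplicative right (resp. left) Hom-alternative algebra, and let $[x,y]=x\ast y-y\ast x$. Define a ternary operation on $A$ by $$(x,y,z)=[[x,y],\alpha(z)]-2\,as(z,x,y)\qquad\text{(resp. } (x,y,z)=[[x,y],\alpha(z)]-2\,as(x,y,z)\text{)}\qquad (x,y,z\in A).$$ Then $(A,(,,),\alpha^2)$ is a Hom-Lie triple system and $(A,[,],(,,),\alpha)$ is a Hom-Bol algebra.
   Context: All vector spaces and algebras are over an algebraically closed field $\mathbb{K}$ of characteristic $0$. A Hom-algebra is a triple $(A,\ast,\alpha)$ where $A$ is a $\mathbb{K}$-vector space, $\ast:A\times A\to A$ is bilinear and $\alpha:A\to A$ is linear. It is multiplicative if $\alpha(x\ast y)=\alpha(x)\ast\alpha(y)$ for all $x,y\in A$. Its Hom-associator is $as(x,y,z)=(x\ast y)\ast\alpha(z)-\alpha(x)\ast(y\ast z)$. It is right Hom-alternative if $as(x,y,y)=0$ for all $x,y\in A$, and left Hom-alternative if $as(x,x,y)=0$ for all $x,y\in A$. Powers $\alpha^k$ denote $k$-fold composition. A Hom-Lie triple system $(A,[,,],\beta)$ (with both twisting maps equal to $\beta$) consists of a $\mathbb{K}$-vector space $A$, a trilinear map $[,,]:A\times A\times A\to A$ and a linear map $\beta:A\to A$ such that, for all $x,y,z,u,v,w\in A$: (1) $[x,y,z]=-[y,x,z]$; (2) $[x,y,z]+[y,z,x]+[z,x,y]=0$; (3) $[\beta(x),\beta(y),[u,v,w]]=[[x,y,u],\beta(v),\beta(w)]+[\beta(u),[x,y,v],\beta(w)]+[\beta(u),\beta(v),[x,y,w]]$.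 A Hom-Bol algebra is a quadruple $(A,[,],(,,),\alpha)$ with $A$ a $\mathbb{K}$-vector space, $[,]$ a bilinear operation, $(,,)$ a trilinear operation on $A$, and $\alpha:A\to A$ linear such that, for all $u,v,w,x,y,z\in A$: (HB1) $\alpha([x,y])=[\alpha(x),\alpha(y)]$; (HB2) $\alpha((x,y,z))=(\alpha(x),\alpha(y),\alpha(z))$; (HB3) $[x,y]=-[y,x]$; (HB4) $(x,y,z)=-(y,x,z)$; (HB5) $(x,y,z)+(y,z,x)+(z,x,y)=0$; (HB6) $(\alpha(x),\alpha(y),[u,v])=[(x,y,u),\alpha^2(v)]+[\alpha^2(u),(x,y,v)]+(\alpha(u),\alpha(v),[x,y])-[[\alpha(u),\alpha(v)],[\alpha(x),\alpha(y)]]$; (HB7) $(\alpha^2(x),\alpha^2(y),(u,v,w))=((x,y,u),\alpha^2(v),\alpha^2(w))+(\alpha^2(u),(x,y,v),\alpha^2(w))+(\alpha^2(u),\alpha^2(v),(x,y,w))$. *)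

(* Defs.v *)
From HB Require Import structures.
From mathcomp Require Import all_boot all_order all_algebra.
Set Implicit Arguments.
Unset Strict Implicit.
Unset Printing Implicit Defensive.
Import GRing.Theory.
Local Open Scope ring_scope.

Section HomAlgebra.
Variables (K : fieldType) (A : lmodType K).
Variables (star : {bilinear A -> A -> A}) (alpha : {linear A -> A}).

Definition multiplicative_hom_alg : Prop :=
  forall x y, alpha (star x y) = star (alpha x) (alpha y).

Definition hom_as (x y z : A) : A :=
  star (star x y) (alpha z) - star (alpha x) (star y z).

Definition right_hom_alternative : Prop := forall x y, hom_as x y y = 0.

Definition left_hom_alternative : Prop := forall x y, hom_as x x y = 0.

Definition commutator (x y : A) : A := star x y - star y x.

Definition right_ternary (x y z : A) : A :=
  commutator (commutator x y) (alpha z) - 2%:R *: hom_as z x y.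

Definition left_ternary (x y z : A) : A :=
  commutator (commutator x y) (alpha z) - 2%:R *: hom_as x y z.

End HomAlgebra.

Section TernaryStructures.
Variables (K : fieldType) (A : lmodType K).

Definition trilinear (t : A -> A -> A -> A) : Prop :=
  [/\ forall y z, linear (fun x => t x y z),
      forall x z, linear (fun y => t x y z)
    & forall x y, linear (fun z => t x y z)].

Record hom_lie_triple_system (t : A -> A -> A -> A) (beta : A -> A) : Prop :=
  HomLieTripleSystem {
    hlts_trilinear : trilinear t;
    hlts_linear : linear beta;
    hlts_skew : forall x y z, t x y z = - t y x z;
    hlts_cyclic : forall x y z, t x y z + t y z x + t z x y = 0;
    hlts_nambu : forall x y u v w,
      t (beta x) (beta y) (t u v w) =
        t (t x y u) (beta v) (beta w) + t (beta u) (t x y v) (beta w)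
        + t (beta u) (beta v) (t x y w)
  }.

Record hom_bol_algebra (b : A -> A -> A) (t : A -> A -> A -> A)
    (alpha : A -> A) : Prop := HomBolAlgebra {
  hbol_bilinear : bilinear_for *:%R *:%R b;
  hbol_trilinear : trilinear t;
  hbol_linear : linear alpha;
  hbol_mult2 : forall x y, alpha (b x y) = b (alpha x) (alpha y);
  hbol_mult3 : forall x y z,
    alpha (t x y z) = t (alpha x) (alpha y) (alpha z);
  hbol_skew2 : forall x y, b x y = - b y x;
  hbol_skew3 : forall x y z, t x y z = - t y x z;
  hbol_cyclic : forall x y z, t x y z + t y z x + t z x y = 0;
  hbol_compat : forall x y u v,
    t (alpha x) (alpha y) (b u v) =
      b (t x y u) (iter 2 alpha v) + b (iter 2 alpha u) (t x y v)
      + t (alpha u) (alpha v) (b x y)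
      - b (b (alpha u) (alpha v)) (b (alpha x) (alpha y));
  hbol_nambu : forall x y u v w,
    t (iter 2 alpha x) (iter 2 alpha y) (t u v w) =
      t (t x y u) (iter 2 alpha v) (iter 2 alpha w)
      + t (iter 2 alpha u) (t x y v) (iter 2 alpha w)
      + t (iter 2 alpha u) (iter 2 alpha v) (t x y w)
}.

End TernaryStructures.

(* Main.v *)
From HB Require Import structures.
Require Import Defs.
From mathcomp Require Import all_boot all_order all_algebra.
Import GRing.Theory.
Local Open Scope ring_scope.
Set Implicit Arguments.
Unset Strict Implicit.
Unset Printing Implicit Defensive.

(** Write x ∘ y = x ⋆ y + y ⋆ x, and let the right multiplication R_x act on the
    right, so that z R_x R_y = (z ⋆ x) ⋆ y.  In the untwisted case (alpha = id),
    right alternativity says that R_(x ∘ y) = R_x R_y + R_y R_x, and the ternary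
    operation has two descriptions:
    (x, y, z) = [x, y] ⋆ z - z [R_x, R_y] = (z ∘ y) ∘ x - (z ∘ x) ∘ y.
    The second makes skew-symmetry and the cyclic identity evident.  It also
    gives R_(x, y, z) = [[R_x, R_y], R_z].  This computes v ⋆ (x, y, u), while
    the first description computes (x, y, u) ⋆ v.  On adding or subtracting the
    two, and symmetrizing or skew-symmetrizing in u and v, the terms
    (u [R_x, R_y]) ⋆ v cancel.  The sum says that (x, y, -) is a derivation of ∘;
    the difference is the compatibility law between bracket and ternary
    operation in a Bol algebra.  Finally a derivation of ∘ is a derivation of
    any operation built from ∘, and the second description then yields the
    Nambu identity.

    The twisted case follows the same computations.  All the terms of a Hom
    identity carry a given variable at the same level, which is its depth in
    the product plus the number of applications of alpha to it; since alpha is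
    multiplicative, it can be pushed to the leaves, and each untwisted step has
    exactly one twisted form.  The core of the argument is [mul_jordan],
    [right_ternaryE], [right_ternary_jordan] and [mul_right_ternary].

    The left case is the right case for the opposite product, which leaves the
    ternary operation unchanged and negates the bracket.  The axioms of a
    Hom-Bol algebra are stable under this change of sign because every term of
    the laws involving the bracket has odd degree in it. *)

(** * Auxiliary products *)

Section Products.
Variables (K : fieldType) (A : lmodType K).
Variables (star : {bilinear A -> A -> A}) (alpha : {linear A -> A}).

Definition jordan (x y : A) := star x y + star y x.
(** The commutator of the twisted right multiplications by [x] and [y],
    acting on [z]. *)
Definition rcomm (x y z : A) :=
  star (star z x) (alpha y) - star (star z y) (alpha x).
Definition opposite (x y : A) := star y x.

Lemma commutator_is_bilinear : bilinear_for *:%R *:%R (commutator star).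
Proof.
by split=> z a x y /=; rewrite /commutator linearPl linearPr opprD addrACA scalerBr.
Qed.
HB.instance Definition _ := bilinear_isBilinear.Build K A A A *:%R *:%R
  (commutator star) commutator_is_bilinear.

Lemma jordan_is_bilinear : bilinear_for *:%R *:%R jordan.
Proof.
by split=> z a x y /=; rewrite /jordan linearPl linearPr addrACA scalerDr.
Qed.
HB.instance Definition _ := bilinear_isBilinear.Build K A A A *:%R *:%R
  jordan jordan_is_bilinear.

Lemma opposite_is_bilinear : bilinear_for *:%R *:%R opposite.
Proof. by split=> z a x y /=; rewrite /opposite (linearPl, linearPr). Qed.
HB.instance Definition _ := bilinear_isBilinear.Build K A A A *:%R *:%R
  opposite opposite_is_bilinear.

Lemma rcomm_is_linear x y : linear (rcomm x y).
Proof.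
by move=> a u v /=; rewrite /rcomm !linearPl opprD addrACA scalerBr.
Qed.
HB.instance Definition _ x y := GRing.isLinear.Build K A A *:%R (rcomm x y)
  (rcomm_is_linear x y).

Lemma jordanC x y : jordan x y = jordan y x.
Proof. exact: addrC. Qed.

End Products.

(** * Right Hom-alternative algebras *)

Section RightHomAlternative.
Variables (K : fieldType) (A : lmodType K).
Variables (star : {bilinear A -> A -> A}) (alpha : {linear A -> A}).
Hypothesis alphaM : multiplicative_hom_alg star alpha.
Hypothesis right_alt : right_hom_alternative star alpha.
Implicit Types x y z u v w : A.

Local Notation "x ⋆ y" := (star x y) (at level 40, left associativity).
Local Notation "x ∘ y" := (jordan star x y) (at level 40, left associativity).
Local Notation "[[ x , y ]]" := (commutator star x y).
Local Notation tern := (right_ternary star alpha).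
Local Notation rc := (rcomm star alpha).

Lemma alpha_jordan x y : alpha (x ∘ y) = alpha x ∘ alpha y.
Proof. by rewrite /jordan linearD !alphaM. Qed.

Lemma alpha_commutator x y : alpha [[x, y]] = [[alpha x, alpha y]].
Proof. by rewrite /commutator linearB !alphaM. Qed.

Lemma alpha_right_ternary x y z :
  alpha (tern x y z) = tern (alpha x) (alpha y) (alpha z).
Proof.
by rewrite /right_ternary linearB linearZ !alpha_commutator /hom_as linearB !alphaM.
Qed.

Lemma hom_as_skew x y z : hom_as star alpha z x y = - hom_as star alpha z y x.
Proof.
have asD a b c : hom_as star alpha z (a + b) c
    = hom_as star alpha z a c + hom_as star alpha z b c.
  by rewrite /hom_as linearDr !linearDl linearDr opprD addrACA.
have asDr a b c : hom_as star alpha z a (b + c)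
    = hom_as star alpha z a b + hom_as star alpha z a c.
  by rewrite /hom_as linearD !linearDr opprD addrACA.
have := right_alt z (x + y); rewrite asD !asDr.
by rewrite !right_alt add0r addr0 => /eqP; rewrite addr_eq0 => /eqP.
Qed.

(** Polarized right alternativity in operator form: R_(x ∘ y) is the symmetrized
    product of R_x and R_y. *)
Lemma mul_jordan x y z :
  alpha z ⋆ (x ∘ y) = (z ⋆ x) ⋆ alpha y + (z ⋆ y) ⋆ alpha x.
Proof.
have /eqP := hom_as_skew x y z; rewrite -addr_eq0 /hom_as addrACA -opprD.
by rewrite subr_eq0 -linearDr => /eqP.
Qed.

(** The factor 2 of the associator is absorbed by its skew-symmetry, and the
    right-nested products in the two associators cancel those of the double
    commutator. *)
Lemma right_ternaryE x y z : tern x y z = [[x, y]] ⋆ alpha z - rc x y z.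
Proof.
rewrite /right_ternary scaler_nat mulr2n {1}hom_as_skew.
rewrite {1}/commutator -addrA; congr (_ + _).
rewrite /rcomm /hom_as /commutator linearBr !opprD !opprK.
set a := _ ⋆ (x ⋆ y); set b := _ ⋆ (y ⋆ x).
rewrite (AC (2*(2*2)) ((1*6)*(2*4)*(5*3))) /=.
by rewrite addNr subrr add0r add0r.
Qed.

(** The ternary operation is the triple product by which a (Hom-)Jordan algebra
    becomes a Lie triple system. *)
Lemma right_ternary_jordan x y z :
  tern x y z = (z ∘ y) ∘ alpha x - (z ∘ x) ∘ alpha y.
Proof.
(* The second line is symmetric in a and b, so it cancels in the difference. *)
have H a b c : (c ∘ b) ∘ alpha a = (c ⋆ b) ⋆ alpha a + (a ⋆ b) ⋆ alpha c
     + ((b ⋆ c) ⋆ alpha a + (a ⋆ c) ⋆ alpha b).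
  by rewrite {1}/jordan mul_jordan linearDl [X in _ + X]addrC addrACA.
rewrite !H right_ternaryE /rcomm linearBl opprB [X in _ - (_ + X)]addrC.
by rewrite opprD [RHS]addrACA subrr addr0 opprD [RHS]addrACA addrC.
Qed.

(** The operator identity R_(x, y, u) = [[R_x, R_y], R_u]: by [mul_jordan] each
    half of [right_ternary_jordan] is a Jordan triple of right multiplications,
    whose part symmetric in [x] and [y] cancels. *)
Lemma mul_right_ternary x y u v :
  alpha (alpha v) ⋆ tern x y u
  = rc x y v ⋆ alpha (alpha u) - rc (alpha x) (alpha y) (v ⋆ u).
Proof.
(* Here too the last line is symmetric in a and b. *)
have H a b : alpha (alpha v) ⋆ ((u ∘ b) ∘ alpha a) =
   ((v ⋆ u) ⋆ alpha b) ⋆ alpha (alpha a) + (v ⋆ a ⋆ alpha b) ⋆ alpha (alpha u)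
   + ((v ⋆ b) ⋆ alpha u ⋆ alpha (alpha a) + (v ⋆ a ⋆ alpha u) ⋆ alpha (alpha b)).
  rewrite !mul_jordan -alphaM alpha_jordan mul_jordan linearDl.
  by rewrite (AC (2*2) ((1*4)*(2*3))).
rewrite right_ternary_jordan linearBr !H.
rewrite [X in _ - (_ + X)]addrC opprD addrACA subrr addr0 opprD addrACA.
by rewrite addrC /rcomm linearBl opprB.
Qed.

Lemma right_ternary_mul x y u v :
  tern x y u ⋆ alpha (alpha v)
  = [[x, y]] ⋆ alpha u ⋆ alpha (alpha v) - rc x y u ⋆ alpha (alpha v).
Proof. by rewrite right_ternaryE linearBl. Qed.

(** On the right-hand side the four terms of the form [rc x y _ ⋆ _] cancel in
    pairs between [right_ternary_mul] and [mul_right_ternary]. *)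
Lemma right_ternary_derivation x y u v :
  tern (alpha x) (alpha y) (u ∘ v)
  = tern x y u ∘ alpha (alpha v) + alpha (alpha u) ∘ tern x y v.
Proof.
rewrite right_ternaryE -alpha_commutator alpha_jordan mul_jordan.
rewrite [rc _ _ (_ ∘ _)]linearD [X in _ + X]opprD.
rewrite /jordan !mul_right_ternary !right_ternary_mul.
rewrite [RHS](AC ((2*2)*(2*2)) (((1*7)*(6*4))*((2*5)*(3*8)))) /=.
by rewrite addNr subrr !addr0.
Qed.

(** The same terms cancel as for [∘], but now the surviving ones are skew in
    [u] and [v], hence form commutators of right multiplications.  Comparing
    with [right_ternaryE] measures how far [tern x y] is from being a derivation
    of the commutator. *)
Lemma commutator_right_ternary x y u v :
  [[tern x y u, alpha (alpha v)]] + [[alpha (alpha u), tern x y v]]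
  = rc (alpha u) (alpha v) [[x, y]] - rc (alpha x) (alpha y) [[u, v]].
Proof.
have rcB a b : rc (alpha x) (alpha y) (a - b)
    = rc (alpha x) (alpha y) a - rc (alpha x) (alpha y) b by exact: linearB.
rewrite /commutator rcB !mul_right_ternary !right_ternary_mul.
rewrite (opprB (_ ⋆ alpha (alpha u))) (opprB _ (_ ⋆ alpha (alpha u))).
rewrite (opprB (rc _ _ _)).
rewrite [LHS](AC ((2*2)*(2*2)) (((1*8)*(3*6))*((2*5)*(7*4)))) /=.
by rewrite addNr subrr !addr0.
Qed.

Lemma right_ternary_commutator x y u v :
  tern (alpha x) (alpha y) [[u, v]]
  = [[tern x y u, alpha (alpha v)]] + [[alpha (alpha u), tern x y v]]
    + tern (alpha u) (alpha v) [[x, y]]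
    - [[ [[alpha u, alpha v]], [[alpha x, alpha y]] ]].
Proof.
rewrite commutator_right_ternary !right_ternaryE !alpha_commutator.
rewrite [ [[ [[_, _]], _]] ]/commutator.
rewrite (opprB (_ ⋆ [[_, _]])) [X in _ = X + _]addrC.
by rewrite subrKA [RHS]addrC subrKA.
Qed.

Lemma right_ternary_trilinear : trilinear tern.
Proof.
split=> [y z|x z|x y] a u v; rewrite !right_ternary_jordan scalerBr.
- by rewrite linearP !linearPr !linearPl opprD addrACA.
- by rewrite linearP !linearPr !linearPl opprD addrACA.
- by rewrite !linearPl opprD addrACA.
Qed.

(** Both sides are built from ∘ by [right_ternary_jordan]; expanding the left
    one with the derivation property, applied twice, gives the six terms of the
    right one. *)
Lemma right_ternary_nambu x y u v w :
  tern (alpha (alpha x)) (alpha (alpha y)) (tern u v w)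
  = tern (tern x y u) (alpha (alpha v)) (alpha (alpha w))
    + tern (alpha (alpha u)) (tern x y v) (alpha (alpha w))
    + tern (alpha (alpha u)) (alpha (alpha v)) (tern x y w).
Proof.
have [_ _ lin3] := right_ternary_trilinear.
rewrite [tern u v w]right_ternary_jordan (zmod_morphism_linear (lin3 _ _)).
rewrite !right_ternary_derivation -!alpha_right_ternary !alpha_jordan.
rewrite (linearDl _ (alpha _)) [in X in _ - X](linearDl _ (alpha _)).
rewrite (right_ternary_jordan (tern x y u)) (right_ternary_jordan _ (tern x y v)).
rewrite (right_ternary_jordan _ _ (tern x y w)).
rewrite [RHS](AC (2*2*2) (((5*3)*1)*((6*2)*4))) /=.
by rewrite (opprD (_ + _)) (opprD (_ ∘ _) (_ ∘ _)).
Qed.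

Lemma right_ternary_skew x y z : tern x y z = - tern y x z.
Proof. by rewrite !right_ternary_jordan opprB. Qed.

Lemma right_ternary_cyclic x y z : tern x y z + tern y z x + tern z x y = 0.
Proof.
rewrite !right_ternary_jordan (jordanC star z y) (jordanC star x z).
by rewrite (jordanC star y x) !subrKA subrr.
Qed.

Lemma right_hom_lie_triple_system : hom_lie_triple_system tern (iter 2 alpha).
Proof.
split; first exact: right_ternary_trilinear.
- by move=> a x y; rewrite /= !linearP.
- exact: right_ternary_skew.
- exact: right_ternary_cyclic.
- exact: right_ternary_nambu.
Qed.

Lemma right_hom_bol_algebra : hom_bol_algebra (commutator star) tern alpha.
Proof.
split.
- exact: commutator_is_bilinear.
- exact: right_ternary_trilinear.
- exact: linearP.
- exact: alpha_commutator.
- exact: alpha_right_ternary.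
- by move=> x y; rewrite /commutator opprB.
- exact: right_ternary_skew.
- exact: right_ternary_cyclic.
- exact: right_ternary_commutator.
- exact: right_ternary_nambu.
Qed.

End RightHomAlternative.

(** * Changing the sign of the bracket *)

Lemma linear_opp (K : fieldType) (A : lmodType K) (f : A -> A) :
  linear f -> forall x, f (- x) = - f x.
Proof.
move=> f_lin x; have fB := zmod_morphism_linear f_lin.
by rewrite -[- x]sub0r fB -{1}(subrr 0) fB subrr sub0r.
Qed.

Section Transport.
Variables (K : fieldType) (A : lmodType K).
Variables (b b' : A -> A -> A) (t t' : A -> A -> A -> A).
Hypothesis eq_t : forall x y z, t' x y z = t x y z.
Hypothesis opp_b : forall x y, b' x y = - b x y.

Lemma eq_trilinear : trilinear t -> trilinear t'.
Proof.
by case=> t1 t2 t3; split=> [y z|x z|x y] a u v; rewrite !eq_t (t1, t2, t3).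
Qed.

Lemma eq_hom_lie_triple_system beta :
  hom_lie_triple_system t beta -> hom_lie_triple_system t' beta.
Proof.
case=> t_lin beta_lin skew cyc nambu; split=> //; first exact: eq_trilinear.
- by move=> x y z; rewrite !eq_t.
- by move=> x y z; rewrite !eq_t.
- by move=> x y u v w; rewrite !eq_t nambu.
Qed.

(** Only the compatibility law mixes the bracket with the ternary operation, and
    each of its terms contains one or three brackets, so the whole law changes
    sign. *)
Lemma opp_hom_bol_algebra alpha :
  hom_bol_algebra b t alpha -> hom_bol_algebra b' t' alpha.
Proof.
case=> b_lin t_lin alpha_lin mul2 mul3 skew2 skew3 cyc compat nambu.
have tN x y z : t x y (- z) = - t x y z by case: t_lin => _ _ /(_ x y)/linear_opp.
have bNl x y : b (- x) y = - b x y by apply: (linear_opp (b_lin.1 y)).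
have bNr x y : b x (- y) = - b x y by apply: (linear_opp (b_lin.2 x)).
have alphaN x : alpha (- x) = - alpha x by apply: linear_opp.
split=> //.
- split=> z a x y /=; rewrite !opp_b.
    by rewrite b_lin.1 opprD scalerN.
  by rewrite b_lin.2 opprD scalerN.
- exact: eq_trilinear.
- by move=> x y; rewrite !opp_b alphaN mul2.
- by move=> x y z; rewrite !eq_t.
- by move=> x y; rewrite !opp_b skew2.
- by move=> x y z; rewrite !eq_t.
- by move=> x y z; rewrite !eq_t.
- move=> x y u v; rewrite !eq_t !opp_b !tN compat bNl bNr opprK.
  by rewrite !opprD opprK.
- by move=> x y u v w; rewrite !eq_t nambu.
Qed.

End Transport.

(** * Left Hom-alternative algebras *)

Section LeftHomAlternative.
Variables (K : fieldType) (A : lmodType K).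
Variables (star : {bilinear A -> A -> A}) (alpha : {linear A -> A}).

Lemma commutator_opposite x y :
  commutator (opposite star) x y = - commutator star x y.
Proof. by rewrite /commutator opprB. Qed.

Lemma hom_as_opposite x y z :
  hom_as (opposite star) alpha x y z = - hom_as star alpha z y x.
Proof. by rewrite /hom_as opprB. Qed.

Lemma opposite_multiplicative :
  multiplicative_hom_alg star alpha ->
  multiplicative_hom_alg (opposite star) alpha.
Proof. by move=> alphaM x y; apply: alphaM. Qed.

Lemma opposite_right_alternative :
  left_hom_alternative star alpha ->
  right_hom_alternative (opposite star) alpha.
Proof. by move=> left_alt x y; rewrite hom_as_opposite left_alt oppr0. Qed.

(** The double commutator has an even number of brackets; on the associator,
    the sign from reversal is compensated by skew-symmetry. *)
Lemma left_ternaryE :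
  left_hom_alternative star alpha -> forall x y z,
  left_ternary star alpha x y z = right_ternary (opposite star) alpha x y z.
Proof.
move=> /opposite_right_alternative right_alt x y z.
rewrite /left_ternary /right_ternary !commutator_opposite linearNl opprK.
by rewrite (hom_as_skew right_alt) hom_as_opposite opprK.
Qed.

End LeftHomAlternative.

Theorem theorem4p4 (K : closedFieldType) (charK0 : [pchar K] =i pred0)
    (A : lmodType K) (star : {bilinear A -> A -> A}) (alpha : {linear A -> A})
    (halpha : multiplicative_hom_alg star alpha) :
  (right_hom_alternative star alpha ->
     hom_lie_triple_system (right_ternary star alpha) (iter 2 alpha) /\
     hom_bol_algebra (commutator star) (right_ternary star alpha) alpha) /\
  (left_hom_alternative star alpha ->
     hom_lie_triple_system (left_ternary star alpha) (iter 2 alpha) /\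
     hom_bol_algebra (commutator star) (left_ternary star alpha) alpha).
Proof.
split=> [right_alt | left_alt].
  by split; [apply: right_hom_lie_triple_system | apply: right_hom_bol_algebra].
have alphaM := opposite_multiplicative halpha.
have right_alt := opposite_right_alternative left_alt.
have eq_t := left_ternaryE left_alt.
split.
  apply: (eq_hom_lie_triple_system eq_t).
  exact: right_hom_lie_triple_system.
apply: (opp_hom_bol_algebra eq_t _ (right_hom_bol_algebra alphaM right_alt)).
by move=> x y; rewrite commutator_opposite opprK.
Qed.
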